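(* Let $(X,d)$ and $(Y,\rho)$ be two compact metric spaces, let $f_{1,\infty}$ be a sequence of continuous selfmaps of $X$, let $g_{1,\infty}$ be a sequence of continuous selfmaps of $Y$, and let $K$ be a nonempty subset of $X$. If $(X,f_{1,\infty})$ is equisemiconjugate with $(Y,g_{1,\infty})$ via a topological equisemiconjugacy $\pi_{1,\infty}=(\pi_i)_{i\ge1}$, then $$D(f_{1,\infty},K)\ge D(g_{1,\infty},\pi_1(K)).$$ If $(X,f_{1,\infty})$ is equiconjugate with $(Y,g_{1,\infty})$ via $\pi_{1,\infty}$, then moreover $$D(f_{1,\infty},K)=D(g_{1,\infty},\pi_1(K)).$$ In particular, $D(f_{1,\infty},X)$ is invariant up to equiconjugacy, i.e. in the equiconjugate case $D(f_{1,\infty},X)=D(g_{1,\infty},Y)$.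
   Context: For a sequence $f_{1,\infty}=(f_i)_{i\ge1}$ of continuous selfmaps of a compact space $X$, put $f_1^0=\mathrm{id}_X$ and $f_1^j=f_j\circ\cdots\circ f_1$ for $j\ge 1$. Equisemiconjugacy. Let $\pi_{1,\infty}=(\pi_i)_{i\ge1}$ be a sequence of surjective maps $X\to Y$ that is equicontinuous (for every $\varepsilon>0$ there is $\delta>0$ such that $d(x,x')<\delta$ implies $\rho(\pi_i(x),\pi_i(x'))<\varepsilon$ for all $i\ge 1$). If $\pi_{i+1}\circ f_i=g_i\circ\pi_i$ for all $i\ge1$, then $\pi_{1,\infty}$ is a topological equisemiconjugacy between $f_{1,\infty}$ and $g_{1,\infty}$, and $(X,f_{1,\infty})$ is equisemiconjugate with $(Y,g_{1,\infty})$. If, in addition, all $\pi_i$ are homeomorphisms and the sequence of inverses $(\pi_i^{-1})_{i\ge1}$ is also equicontinuous, then $\pi_{1,\infty}$ equiconjugates $(X,f_{1,\infty})$ and $(Y,g_{1,\infty})$. Pesin topological entropy dimension (defined in the same way for $(Y,g_{1,\infty})$). For a finite open cover $\mathcal{U}$ of $X$, let $S(\mathcal{U})$ be the set of all finite strings $\mathbf{U}=(U_{i_0},\dots,U_{i_{m-1}})$ of elements of $\mathcal{U}$, with length $m(\mathbf{U})=m$, and let $X(\mathbf{U})=\{x\in X: f_1^j(x)\in U_{i_j},\ 0\le j\le m(\mathbf{U})-1\}$. A collection $\mathcal{G}\subseteq S(\mathcal{U})$ covers $K$ if $K\subseteq\bigcup_{\mathbf{U}\in\mathcal{G}}X(\mathbf{U})$.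 For $\alpha\in\mathbb{R}$, $s>0$ let $M(f_{1,\infty},K,s,\mathcal{U},\alpha,N)=\inf_{\mathcal{G}}\sum_{\mathbf{U}\in\mathcal{G}}e^{-\alpha m(\mathbf{U})^s}$, the infimum over all finite or countable $\mathcal{G}\subseteq S(\mathcal{U})$ covering $K$ with $m(\mathbf{U})\ge N$ for all $\mathbf{U}\in\mathcal{G}$. Let $m(f_{1,\infty},K,s,\mathcal{U},\alpha)=\lim_{N\to\infty}M(f_{1,\infty},K,s,\mathcal{U},\alpha,N)$, $D(f_{1,\infty},K,s,\mathcal{U})=\inf\{\alpha: m(f_{1,\infty},K,s,\mathcal{U},\alpha)=0\}=\sup\{\alpha: m(f_{1,\infty},K,s,\mathcal{U},\alpha)=\infty\}$, and $D(f_{1,\infty},K,s)=\sup_{\mathcal{U}}D(f_{1,\infty},K,s,\mathcal{U})$ over finite open covers $\mathcal{U}$ of $X$. Then $D(f_{1,\infty},K)=\sup\{s>0:D(f_{1,\infty},K,s)=+\infty\}=\inf\{s>0:D(f_{1,\infty},K,s)=0\}$, with $\inf\emptyset=+\infty$ and $\sup\emptyset=0$ for sets of $s>0$. *)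

(* Defs.v *)
From HB Require Import structures.
From mathcomp Require Import all_boot all_order all_algebra.
From mathcomp Require Import all_classical all_reals all_analysis.

Set Implicit Arguments.
Unset Strict Implicit.
Unset Printing Implicit Defensive.

Import Order.TTheory GRing.Theory Num.Theory.
Import numFieldNormedType.Exports.

Local Open Scope classical_set_scope.
Local Open Scope ring_scope.

(* Sequences are indexed from 0: [f i] is f_{i+1}, [p i] is pi_{i+1}; in
   particular pi_1 is [p 0]. *)

(* [orbit_map f j] is f_1^j = f_j o ... o f_1, with f_1^0 = id. *)
Fixpoint orbit_map (X : Type) (f : nat -> X -> X) (j : nat) : X -> X :=
  if j is j'.+1 then f j' \o orbit_map f j' else id.

(* Uniform equicontinuity; the library's [equicontinuous] is the pointwise
   notion. *)
Definition unif_equicontinuous (R : realType) (X Y : metricType R)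
    (p : nat -> X -> Y) : Prop :=
  forall e : R, 0 < e -> exists2 d : R, 0 < d &
    forall x x' : X, mdist x x' < d -> forall i, mdist (p i x) (p i x') < e.

Definition equisemiconjugacy (R : realType) (X Y : metricType R)
    (f : nat -> X -> X) (g : nat -> Y -> Y) (p : nat -> X -> Y) : Prop :=
  [/\ forall i, range (p i) = [set: Y],
      unif_equicontinuous p &
      forall i, p i.+1 \o f i = g i \o p i].

Definition equiconjugacy (R : realType) (X Y : metricType R)
    (f : nat -> X -> X) (g : nat -> Y -> Y) (p : nat -> X -> Y) : Prop :=
  equisemiconjugacy f g p /\
  exists q : nat -> Y -> X,
    [/\ forall i, cancel (p i) (q i) /\ cancel (q i) (p i),
        forall i, continuous (p i) /\ continuous (q i) &
        unif_equicontinuous q].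

Section PesinEntropyDimension.
Context {R : realType} {X : topologicalType}.
Implicit Types (f : nat -> X -> X) (K : set X) (U : set (set X)).
Implicit Types (u : seq (set X)) (G : set (seq (set X))).
Implicit Types (s alpha : R) (N : nat).

Definition finite_open_cover U : Prop :=
  [/\ finite_set U, U `<=` open & \bigcup_(A in U) A = [set: X]].

Definition strings U : set (seq (set X)) :=
  [set u : seq (set X) | forall A, A \in u -> U A].

(* The letter at position j constrains the point f_1^j x, for 0 <= j < size u. *)
Definition string_set f u : set X :=
  [set x | forall j, (j < size u)%N -> nth set0 u j (orbit_map f j x)].

Definition admissible f K U N : set (set (seq (set X))) :=
  [set G | [/\ G `<=` strings U, countable G,
               forall u, G u -> (N <= size u)%N &
               K `<=` \bigcup_(u in G) string_set f u]].

Definition pesin_M f K s U alpha N : \bar R :=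
  ereal_inf [set (\esum_(u in G) (expR (- alpha * (size u)%:R `^ s))%:E)%E
            | G in admissible f K U N].

(* [pesin_M] is nondecreasing in N, so the limit exists in [\bar R]. *)
Definition pesin_m f K s U alpha : \bar R :=
  limn (pesin_M f K s U alpha).

(* For s > 0 this infimum is also sup {alpha | m = +oo}. *)
Definition pesin_D_cover f K s U : \bar R :=
  ereal_inf [set alpha%:E | alpha in [set alpha | pesin_m f K s U alpha = 0%E]].

Definition pesin_D_s f K s : \bar R :=
  ereal_sup [set pesin_D_cover f K s U | U in finite_open_cover].

End PesinEntropyDimension.

(* [ereal_inf set0 = +oo], as intended. For nonempty K the value is also
   sup {s > 0 | D(s) = +oo}, with sup of the empty set equal to 0. *)
Definition pesin_D (R : realType) (X : topologicalType)
    (f : nat -> X -> X) (K : set X) : \bar R :=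
  ereal_inf [set s%:E | s in [set s : R | 0 < s /\ pesin_D_s f K s = 0%E]].

(* Main.v *)
Require Import Defs.
From HB Require Import structures.
From mathcomp Require Import all_boot all_order all_algebra finmap.
From mathcomp Require Import all_classical all_reals all_analysis.

(** The idea is that a code for the dynamics of [f] can be translated, letter by
    letter, into a code of the same length for the dynamics of [g].

    Let [V] be a finite open cover of [Y], with Lebesgue number [l]: every ball
    of radius [l] lies in an element of [V] ([lebesgue_number]). Equicontinuity
    gives one [d] such that every [p i] maps every ball of radius [d] into a
    ball of radius [l]; cover [X] by finitely many open sets [A] contained in
    such balls ([finite_small_cover]). Then for each time [i] and each letter
    [A] some letter [tau i A] of [V] contains the image of [A] under [p i]. The
    translation depends on the time, because the maps [p i] do, but since [d]
    is the same for all [i] a single finite alphabet on [X] suffices.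

    Replacing the letter [A] at position [i] by [tau i A] keeps lengths, hence
    the weights, and since [p j] sends the [j]-th point of the orbit of [x] to
    the [j]-th point of the orbit of [p 0 x], it turns a family of strings that
    covers [K] into one that covers the image of [K]. Different strings may
    get the same translation, which can only lower the total weight
    ([le_esum_image]). So the quantities [pesin_M], [pesin_m], [pesin_D_cover]
    and [pesin_D_s] do not increase from [f] to [g].

    [pesin_D] is the infimum of the [s] for which [pesin_D_s] is exactly 0, so
    the comparison of the [pesin_D_s] is not yet enough: they must also be
    nonnegative. They are ([pesin_D_s_ge0]), because for a nonpositive
    [alpha] every string has weight at least 1, and covering a nonempty set
    takes at least one string.

    The inverse of an equiconjugacy is an equiconjugacy, which gives the
    equality. *)

Set Implicit Arguments.
Unset Strict Implicit.
Unset Printing Implicit Defensive.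

Import Order.TTheory GRing.Theory Num.Theory.
Import numFieldNormedType.Exports.

Local Open Scope classical_set_scope.
Local Open Scope ring_scope.

(** * Sums over images *)

Lemma esum_subset (R : realType) (T : choiceType) (P Q : set T)
    (a : T -> \bar R) :
  P `<=` Q -> (\esum_(i in P) a i <= \esum_(i in Q) a i)%E.
Proof.
move=> PQ; apply: ereal_sup_le; apply: image_subset => A [finA AP].
by split=> //; exact: subset_trans PQ.
Qed.

(** Choosing one preimage for each point of the image makes the left-hand side
    a subsum of the right-hand side. *)
Lemma le_esum_image (R : realType) (T T' : choiceType) (P : set T)
    (e : T -> T') (a : T' -> \bar R) :
  (\esum_(j in e @` P) a j <= \esum_(i in P) a (e i))%E.
Proof.
have [->|/set0P[x0 _]] := eqVneq P set0; first by rewrite image_set0 !esum_set0.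
have /choice[h hP] : forall j, exists i, (e @` P) j -> P i /\ e i = j.
  move=> j; have [[i Pi eij]|nPj] := pselect ((e @` P) j); first by exists i.
  by exists x0 => /nPj.
have hK : (e \o h) @` (e @` P) = e @` P.
  apply/seteqP; split=> [_ [j Pj <-]|j Pj] /=.
    by have [_ ->] := hP _ Pj.
  by exists j => //=; have [_ ->] := hP _ Pj.
rewrite -hK -image_comp esum_image; last first.
  move=> _ _ /set_mem[j Pj <-] /set_mem[k Pk <-].
  by have [_ ->] := hP _ Pj; have [_ ->] := hP _ Pk => ->.
by apply: esum_subset => _ [j Pj <-]; have [] := hP _ Pj.
Qed.

(** * Compact spaces *)

Lemma lebesgue_number (R : realType) (Y : pseudoMetricType R)
    (cptY : compact [set: Y]) (V : set (set Y)) :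
  V `<=` open -> \bigcup_(A in V) A = [set: Y] ->
  exists2 l : R, 0 < l & forall y, exists2 A, V A & ball y l `<=` A.
Proof.
move=> Vopen Vcover.
have /compact_near_coveringP cov := cptY.
have /cov : forall y : Y, [set: Y] y ->
    \forall y' \near y & l \near 0^'+, exists2 A, V A & ball y' l `<=` A.
  move=> y _; have [A VA Ay] : (\bigcup_(A in V) A) y by rewrite Vcover.
  have /nbhs_ballP[r /= r0 rA] : nbhs y A.
    by apply: open_nbhs_nbhs; split=> //; exact: Vopen.
  exists (ball y (r / 2), [set l | l <= r / 2]) => /=.
    split; first by apply: nbhsx_ballx; rewrite divr_gt0.
    by apply: nbhs_right_le; rewrite divr_gt0.
  move=> [y' l] /= [yy' lr]; exists A => // z y'z; apply: rA.
  rewrite [r]splitr; apply: ball_triangle yy' _; exact: le_ball y'z.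
move=> /(filterI (nbhs_right_gt (0 : R)))/filter_ex[l [l0 lP]].
by exists l => // y; exact: lP.
Qed.

(** The members are interiors of balls: the axioms of [pseudoMetricType] make a
    ball a neighborhood of its center, but not necessarily an open set. *)
Lemma finite_small_cover (R : realType) (X : pseudoMetricType R)
    (cptX : compact [set: X]) (d : R) : 0 < d ->
  exists2 U : set (set X), finite_open_cover U &
    forall A, U A -> exists c, A `<=` ball c d.
Proof.
move=> d0.
have [X0|/set0P[x0 _]] := eqVneq [set: X] set0.
  exists set0 => //; split=> //; by rewrite bigcup_set0 X0.
(* [compact_cover] speaks of pointed spaces; [x0] serves as the distinguished
   point. *)
pose pX : ptopologicalType := HB.pack (X : Type) X (isPointed.Build X x0).
have : cover_compact [set: pX] by rewrite -compact_cover.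
move=> /(_ X [set: X] (fun c => interior (ball c d)))[].
- by move=> c _; exact: open_interior.
- by move=> x _; exists x => //; exact: nbhsx_ballx.
move=> C _ cov; exists [set interior (ball c d) | c in [set` C]].
  split.
  - exact: finite_image.
  - by move=> _ [c _ <-]; exact: open_interior.
  - apply/seteqP; split=> // x _; have [c Cc cx] := cov x I.
    by exists (interior (ball c d)) => //; exists c.
by move=> _ [c _ <-]; exists c; exact: interior_subset.
Qed.

(** * Monotonicity and sign of the entropy dimension functions *)

Section PesinBasics.
Context {R : realType} {X : topologicalType}.
Implicit Types (f : nat -> X -> X) (K : set X) (U : set (set X)).

Lemma pesin_M_nondecreasing f K (s : R) U (alpha : R) :
  nondecreasing_seq (pesin_M f K s U alpha).
Proof.
apply/nondecreasing_seqP => N; apply: ereal_inf_le_tmp; apply: image_subset.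
by move=> G [GU cG GN KG]; split=> // u /GN /ltnW.
Qed.

Lemma is_cvg_pesin_M f K (s : R) U (alpha : R) :
  cvgn (pesin_M f K s U alpha).
Proof.
by apply: ereal_nondecreasing_is_cvgn; exact: pesin_M_nondecreasing.
Qed.

Lemma pesin_M_ge0 f K (s : R) U (alpha : R) N :
  (0 <= pesin_M f K s U alpha N)%E.
Proof.
apply: le_ereal_inf_tmp => _ [G _ <-]; apply: esum_ge0 => u _.
by rewrite lee_fin expR_ge0.
Qed.

Lemma pesin_m_ge0 f K (s : R) U (alpha : R) :
  (0 <= pesin_m f K s U alpha)%E.
Proof.
apply: lime_ge; first exact: is_cvg_pesin_M.
by apply: nearW => N; exact: pesin_M_ge0.
Qed.

Lemma pesin_M_ge1 f K (s : R) U (alpha : R) N :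
  K !=set0 -> alpha <= 0 -> (1 <= pesin_M f K s U alpha N)%E.
Proof.
move=> [x Kx] alpha0; apply: le_ereal_inf_tmp => _ [G [_ _ _ KG] <-].
have [u Gu _] := KG _ Kx.
apply: (@le_trans _ _ (expR (- alpha * (size u)%:R `^ s))%:E).
  by rewrite lee_fin -[leLHS]expR0 ler_expR mulr_ge0 ?oppr_ge0 ?powR_ge0.
rewrite -(esum_set1 (t := u) (a := fun u =>
  (expR (- alpha * (size u)%:R `^ s))%:E)) ?lee_fin ?expR_ge0//.
by apply: esum_subset => _ ->.
Qed.

(** A negative [alpha] cannot make [pesin_m] vanish, so it does not enter the
    infimum. *)
Lemma pesin_D_cover_ge0 f K (s : R) U :
  K !=set0 -> (0 <= pesin_D_cover f K s U)%E.
Proof.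
move=> K0; apply: le_ereal_inf_tmp => _ [alpha m0 <-].
rewrite lee_fin leNgt; apply/negP => alpha0.
have : (1 <= pesin_m f K s U alpha)%E.
  apply: lime_ge; first exact: is_cvg_pesin_M.
  by apply: nearW => N; apply: pesin_M_ge1 => //; exact: ltW.
by rewrite m0 lee_fin ler10.
Qed.

Lemma finite_open_coverT : finite_open_cover [set [set: X]].
Proof.
by split; [exact: finite_set1 | move=> _ ->; exact: openT | rewrite bigcup_set1].
Qed.

Lemma pesin_D_s_ge0 f K (s : R) : K !=set0 -> (0 <= pesin_D_s f K s)%E.
Proof.
move=> K0; apply: (le_trans (pesin_D_cover_ge0 f s [set [set: X]] K0)).
by apply: ereal_sup_ubound; exists [set [set: X]] => //; exact: finite_open_coverT.
Qed.

End PesinBasics.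

(** * Translating strings *)

(** The translation of letters may depend on the time at which they are read. *)
Definition translate (S T : Type) (x0 : S) (tau : nat -> S -> T) (u : seq S) :
  seq T := mkseq (fun j => tau j (nth x0 u j)) (size u).

Lemma orbit_map_intertwine (X Y : Type) (f : nat -> X -> X) (g : nat -> Y -> Y)
    (p : nat -> X -> Y) (fgp : forall i, p i.+1 \o f i = g i \o p i) j x :
  p j (orbit_map f j x) = orbit_map g j (p 0%N x).
Proof.
elim: j => //= j <-.
exact: (congr1 (fun h => h (orbit_map f j x)) (fgp j)).
Qed.

Section Translation.
Context {R : realType} {X Y : topologicalType}.
Variables (f : nat -> X -> X) (g : nat -> Y -> Y) (p : nat -> X -> Y).
Hypothesis fgp : forall i, p i.+1 \o f i = g i \o p i.
Variables (U : set (set X)) (V : set (set Y)) (tau : nat -> set X -> set Y).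
Hypothesis tauV : forall i A, U A -> V (tau i A).
Hypothesis tauP : forall i A, U A -> p i @` A `<=` tau i A.

Lemma admissible_translate K N G : admissible f K U N G ->
  admissible g (p 0%N @` K) V N (translate set0 tau @` G).
Proof.
move=> [GU cG GN KG]; split.
- move=> _ [u Gu <-] _ /mapP[j + ->]; rewrite mem_iota add0n => ju.
  by apply: tauV; apply: (GU _ Gu); exact: mem_nth.
- by apply: sub_countable cG; exact: card_image_le.
- by move=> _ [u Gu <-]; rewrite size_mkseq; exact: GN.
- move=> _ [x Kx <-]; have [u Gu xu] := KG _ Kx.
  exists (translate set0 tau u); first by exists u.
  move=> j; rewrite size_mkseq => ju; rewrite nth_mkseq//.
  rewrite -(orbit_map_intertwine fgp); apply: tauP.
    by apply: (GU _ Gu); exact: mem_nth.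
  by exists (orbit_map f j x) => //; exact: xu.
Qed.

Lemma le_pesin_M K (s alpha : R) N :
  (pesin_M g (p 0%N @` K) s V alpha N <= pesin_M f K s U alpha N)%E.
Proof.
apply: le_ereal_inf_tmp => _ [G admG <-]; apply: ge_ereal_inf.
eexists; first by exists (translate set0 tau @` G);
  [exact: admissible_translate | reflexivity].
apply: (le_trans (le_esum_image _ _ _)).
by apply: le_esum => u _; rewrite size_mkseq.
Qed.

Lemma le_pesin_D_cover K (s : R) :
  (pesin_D_cover g (p 0%N @` K) s V <= pesin_D_cover f K s U)%E.
Proof.
apply: ereal_inf_le_tmp; apply: image_subset => alpha /= m0.
apply/eqP; rewrite eq_le pesin_m_ge0 andbT -m0.
apply: lee_lim; [exact: is_cvg_pesin_M | exact: is_cvg_pesin_M |].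
by apply: nearW => N; exact: le_pesin_M.
Qed.

End Translation.

(** * Comparison along an equisemiconjugacy *)

(** The mesh of [U] is the equicontinuity modulus of the whole family [p] for the
    Lebesgue number of [V], which is why [U] does not depend on the time [i]. *)
Lemma equicontinuous_refining_cover (R : realType) (X Y : metricType R)
    (cptX : compact [set: X]) (cptY : compact [set: Y]) (p : nat -> X -> Y)
    (V : set (set Y)) :
  unif_equicontinuous p -> finite_open_cover V ->
  exists2 U : set (set X), finite_open_cover U &
    exists tau : nat -> set X -> set Y,
      forall i A, U A -> V (tau i A) /\ p i @` A `<=` tau i A.
Proof.
move=> pcont [_ Vopen Vcover].
have [l l0 lP] := lebesgue_number cptY Vopen Vcover.
have [d d0 dP] := pcont _ l0.
have [U Ucov Usmall] := finite_small_cover cptX d0.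
exists U => //.
have /choice[tau tauP] : forall iA : nat * set X, exists B,
    U iA.2 -> V B /\ p iA.1 @` iA.2 `<=` B.
  move=> [i A] /=; have [UA|nUA] := pselect (U A); last by exists set0.
  have [c Ac] := Usmall _ UA; have [B VB lB] := lP (p i c).
  exists B => _; split=> // _ [x Ax <-]; apply: lB.
  rewrite ballEmdist /=; apply: dP.
  by have := Ac _ Ax; rewrite ballEmdist.
by exists (fun i A => tau (i, A)) => i A UA; exact: (tauP (i, A) UA).
Qed.

Lemma le_pesin_D_s (R : realType) (X Y : metricType R)
    (cptX : compact [set: X]) (cptY : compact [set: Y])
    (f : nat -> X -> X) (g : nat -> Y -> Y) (p : nat -> X -> Y)
    (K : set X) (s : R) : equisemiconjugacy f g p ->
  (pesin_D_s g (p 0%N @` K) s <= pesin_D_s f K s)%E.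
Proof.
move=> [_ pcont fgp]; apply: ge_ereal_sup => _ [V Vcov <-].
have [U Ucov [tau tauP]] := equicontinuous_refining_cover cptX cptY pcont Vcov.
apply: le_ereal_sup_tmp; exists (pesin_D_cover f K s U); first by exists U.
by apply: (le_pesin_D_cover fgp (tau := tau)) => i A /(tauP i)[].
Qed.

Lemma le_pesin_D (R : realType) (X Y : metricType R)
    (cptX : compact [set: X]) (cptY : compact [set: Y])
    (f : nat -> X -> X) (g : nat -> Y -> Y) (p : nat -> X -> Y) (K : set X) :
  K !=set0 -> equisemiconjugacy f g p ->
  (pesin_D R g (p 0%N @` K) <= pesin_D R f K)%E.
Proof.
move=> [x Kx] fgp; apply: ereal_inf_le_tmp; apply: image_subset => s [s0 Ds0].
split=> //; apply/eqP; rewrite eq_le -{1}Ds0 le_pesin_D_s//=.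
by apply: pesin_D_s_ge0; exists (p 0%N x), x.
Qed.

Lemma equiconjugacy_inverse (R : realType) (X Y : metricType R)
    (f : nat -> X -> X) (g : nat -> Y -> Y) (p : nat -> X -> Y) :
  equiconjugacy f g p ->
  exists2 q : nat -> Y -> X, equisemiconjugacy g f q &
    cancel (p 0%N) (q 0%N).
Proof.
move=> [[_ _ fgp] [q [pq _ qcont]]]; exists q; last by have [] := pq 0%N.
split=> // i.
  apply/seteqP; split=> // x _; exists (p i x) => //.
  by have [-> _] := pq i.
have [_ qK] := pq i; have [pK _] := pq i.+1.
apply/funext => y /=; rewrite -[in LHS](qK y) -[RHS]pK.
by rewrite [in RHS](congr1 (fun h => h (q i y)) (fgp i) : p i.+1 (f i _) = _).
Qed.

Theorem theorem3p21 (R : realType) (X Y : metricType R)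
    (cptX : compact [set: X]) (cptY : compact [set: Y])
    (f : nat -> X -> X) (f_cont : forall i, continuous (f i))
    (g : nat -> Y -> Y) (g_cont : forall i, continuous (g i))
    (K : set X) (K_neq0 : K !=set0) (p : nat -> X -> Y) :
  (equisemiconjugacy f g p ->
     (pesin_D R g (p 0%N @` K) <= pesin_D R f K)%E) /\
  (equiconjugacy f g p ->
     pesin_D R f K = pesin_D R g (p 0%N @` K) /\
     pesin_D R f [set: X] = pesin_D R g [set: Y]).
Proof.
split=> [|fgp]; first exact: le_pesin_D.
have [q gfq pK] := equiconjugacy_inverse fgp; have [semi _] := fgp.
have D_eq (L : set X) : L !=set0 -> pesin_D R f L = pesin_D R g (p 0%N @` L).
  move=> L0; have qpL : q 0%N @` (p 0%N @` L) = L.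
    rewrite image_comp -[RHS]image_id; apply: eq_imagel => x _; exact: pK.
  apply/eqP; rewrite eq_le (le_pesin_D cptX cptY L0 semi) andbT -{1}qpL.
  by apply: le_pesin_D => //; exact: image_nonempty.
split; first exact: D_eq.
have [/(_ 0%N) <- _ _] := semi; apply: D_eq.
by have [x _] := K_neq0; exists x.
Qed.
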